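(* $Q^{\mathrm{un}}_{\mathrm{Grp}}\mathrm{FO} = \mathrm{CFL}$.
   Context: CFL denotes the class of $\epsilon$-free context-free languages. Words over a finite ordered alphabet are viewed as finite structures with universe $\{1,\dots,n\}$, unary letter predicates $P_a$, linear order $<$, equality, constants min, max; FO denotes first-order logic over this signature (without BIT). Unary Lindström quantifier: for a language $L$ over ordered alphabet $(b_1,\dots,b_t)$ and formulas $\phi_1(x),\dots,\phi_{t-1}(x)$, $Q_L x[\phi_1,\dots,\phi_{t-1}]$ holds on $w$ of length $n$ iff the word of length $n$ whose $i$th letter is $b_j$ for the least $j$ with $w\models\phi_j(i)$, and $b_t$ if none, belongs to $L$. A groupoid is a finite set $G$ with an arbitrary binary operation; $\mathcal W(S,G)$, $S\subseteq G$, is the set of nonempty words over alphabet $G$ evaluating into $S$ under some legal bracketing. $Q^{\mathrm{un}}_{\mathrm{Grp}}\mathrm{FO}$ is the class of languages definable by applying a single unary quantifier $Q_L$, $L=\mathcal W(S,G)$ for some finite groupoid $G$ and $S\subseteq G$, to a tuple of FO formulas. *)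

(* Defs.v *)
From mathcomp Require Import all_boot.
From Stdlib Require Import Relations.

Set Implicit Arguments.
Unset Strict Implicit.
Unset Printing Implicit Defensive.

Definition language (A : Type) := seq A -> Prop.

Record grammar (A : finType) := Grammar {
  nonterminal : finType;
  start : nonterminal;
  productions : seq (nonterminal * seq (nonterminal + A))
}.

Definition sentential_form (A : finType) (g : grammar A) :=
  seq (nonterminal g + A).

Inductive derives1 (A : finType) (g : grammar A) :
    sentential_form g -> sentential_form g -> Prop :=
  Derives1 (u v : sentential_form g) (X : nonterminal g)
      (alpha : sentential_form g) :
    (X, alpha) \in productions g ->
    derives1 (u ++ inl X :: v) (u ++ alpha ++ v).

Definition derives (A : finType) (g : grammar A) :
    relation (sentential_form g) :=
  clos_refl_trans _ (@derives1 A g).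

Definition generated (A : finType) (g : grammar A) : language A :=
  fun w => derives [:: inl (start g)] (map inr w).

(* "Epsilon-free" restricts the language, not the shape of the productions. *)
Definition CFL (A : finType) (L : language A) : Prop :=
  ~ L [::] /\ exists g : grammar A, forall w, L w <-> generated g w.

Inductive term (k : nat) :=
  | Var of 'I_k
  | Min
  | Max.

Arguments Min {k}.
Arguments Max {k}.

(* [formula A k] is the type of first-order formulas whose free variables are
   among the de Bruijn indices [0, ..., k - 1]. *)
Inductive formula (A : Type) : nat -> Type :=
  | Letter k of A & term k : formula A k
  | Less k of term k & term k : formula A k
  | Equal k of term k & term k : formula A k
  | Not k of formula A k : formula A k
  | And k of formula A k & formula A k : formula A k
  | Or k of formula A k & formula A k : formula A k
  | Exists k of formula A k.+1 : formula A k
  | Forall k of formula A k.+1 : formula A k.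

(* Words seen as structures are nonempty, since [Min] and [Max] must denote;
   positions are numbered from 0. *)
Definition eval_term (n k : nat) (v : 'I_k -> 'I_n.+1) (t : term k) : 'I_n.+1 :=
  match t with
  | Var x => v x
  | Min => ord0
  | Max => ord_max
  end.

Definition extend (T : Type) (k : nat) (p : T) (v : 'I_k -> T) : 'I_k.+1 -> T :=
  fun x => if unlift ord0 x is Some y then v y else p.

Fixpoint holds (A : finType) (n : nat) (w : n.+1.-tuple A) (k : nat)
    (phi : formula A k) : ('I_k -> 'I_n.+1) -> bool :=
  match phi in formula _ k return ('I_k -> 'I_n.+1) -> bool with
  | Letter _ a t => fun v => tnth w (eval_term v t) == a
  | Less _ t u => fun v => eval_term v t < eval_term v u
  | Equal _ t u => fun v => eval_term v t == eval_term v u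
  | Not _ f => fun v => ~~ holds w f v
  | And _ f g => fun v => holds w f v && holds w g v
  | Or _ f g => fun v => holds w f v || holds w g v
  | Exists _ f => fun v => [exists p, holds w f (extend p v)]
  | Forall _ f => fun v => [forall p, holds w f (extend p v)]
  end.

(* The ordered alphabet [(b_1, ..., b_t)] is an enumeration [b] of length
   [t = m.+1].  [find] returns the least index of a formula of [phis] true at
   position [i], and [m] if there is none. *)
Definition lindstrom_word (A : finType) (B : Type) (m : nat) (b : 'I_m.+1 -> B)
    (phis : m.-tuple (formula A 1)) (n : nat) (w : n.+1.-tuple A) :
    n.+1.-tuple B :=
  [tuple b (inord (find (fun phi => holds w phi (fun=> i)) phis)) | i < n.+1].

Definition lindstrom (A : finType) (B : Type) (m : nat) (b : 'I_m.+1 -> B)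
    (K : language B) (phis : m.-tuple (formula A 1)) (n : nat)
    (w : n.+1.-tuple A) : Prop :=
  K (lindstrom_word b phis w).

Inductive bracketing (G : Type) :=
  | Leaf of G
  | Node of bracketing G & bracketing G.

Fixpoint frontier (G : Type) (t : bracketing G) : seq G :=
  match t with
  | Leaf g => [:: g]
  | Node l r => frontier l ++ frontier r
  end.

Fixpoint evaluate (G : Type) (op : G -> G -> G) (t : bracketing G) : G :=
  match t with
  | Leaf g => g
  | Node l r => op (evaluate op l) (evaluate op r)
  end.

Definition groupoid_language (G : finType) (op : G -> G -> G) (S : {set G}) :
    language G :=
  fun w => exists t : bracketing G, frontier t = w /\ evaluate op t \in S.

Definition QunGrpFO (A : finType) (L : language A) : Prop :=
  ~ L [::] /\
  exists (G : finType) (op : G -> G -> G) (S : {set G}) (m : nat)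
         (b : 'I_m.+1 -> G) (phis : m.-tuple (formula A 1)),
    bijective b /\
    forall (n : nat) (w : n.+1.-tuple A),
      L w <-> lindstrom b (groupoid_language op S) phis w.

(* Main.v *)
(** A groupoid for a grammar needs no normal form of the grammar: its elements
    are sets of sentential forms of bounded length, and [X * Y] collects the
    forms deriving some [beta ++ gamma] with [beta] in [X] and [gamma] in [Y].
    Evaluating a bracketing of a word yields only forms generating that word, and
    every generating form is reached by some bracketing; first-order formulas
    merely have to relabel each letter by its set of forms.

    Conversely, a first-order formula with one free variable only sees, at a
    position, the letter there and the values of the prefix and of the suffix
    under a map [h] into a finite set such that [h (u ++ v)] is a function of
    [h u] and [h v] (quantifiers are handled by collecting the values of all
    ways of marking a position).  A nonterminal that guesses the [h]-values of
    its word and of both contexts, together with a groupoid element, can thus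
    simulate a bracketing of the relabelled word. *)

Require Import Defs.
From mathcomp Require Import all_boot.
From Stdlib Require Import Relations.
From mathcomp Require Import boolp.

Set Implicit Arguments.
Unset Strict Implicit.
Unset Printing Implicit Defensive.

(** * Big-step semantics of context-free derivations *)

Section Derivations.

Variables (A : finType) (g : grammar A).

(** A forest of derivation trees read from left to right; induction on it splits the generated word
    along the form. *)
Inductive yields : sentential_form g -> seq A -> Prop :=
  | YieldsNil : yields [::] [::]
  | YieldsTerminal a s w : yields s w -> yields (inr a :: s) (a :: w)
  | YieldsNonterminal X alpha s w1 w2 :
      (X, alpha) \in productions g -> yields alpha w1 -> yields s w2 ->
      yields (inl X :: s) (w1 ++ w2).

Lemma derives_context (p q s t : sentential_form g) :
  derives s t -> derives (p ++ s ++ q) (p ++ t ++ q).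
Proof.
elim=> [_ _ [u v X alpha Xalpha]|?|x y z _ xy _ yz]; last exact: rt_trans xy yz.
- apply: rt_step; rewrite -!catA /= !(catA p u).
  exact: Derives1.
- exact: rt_refl.
Qed.

Lemma derives_cat (s1 s2 t1 t2 : sentential_form g) :
  derives s1 t1 -> derives s2 t2 -> derives (s1 ++ s2) (t1 ++ t2).
Proof.
move=> d1 d2; apply: (rt_trans _ _ _ (t1 ++ s2)).
- exact: (derives_context [::] s2 d1).
- by have := derives_context t1 [::] d2; rewrite !cats0.
Qed.

Lemma derives_production X alpha :
  (X, alpha) \in productions g -> derives [:: inl X] alpha.
Proof.
by move=> /(Derives1 [::] [::]); rewrite /= cats0; apply: rt_step.
Qed.

Lemma yields_cat s1 s2 w1 w2 :
  yields s1 w1 -> yields s2 w2 -> yields (s1 ++ s2) (w1 ++ w2).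
Proof.
move=> + y2; elim=> [|a s w _ IH|X alpha s v1 v2 Xalpha ya _ _ IH] //=.
- exact: YieldsTerminal.
- by rewrite -catA; apply: YieldsNonterminal Xalpha ya IH.
Qed.

Lemma yields_catE s1 s2 w :
  yields (s1 ++ s2) w ->
  exists w1 w2, [/\ w = w1 ++ w2, yields s1 w1 & yields s2 w2].
Proof.
elim: s1 w => [|x s1 IH] w /= y; first by exists [::], w; split=> //; constructor.
inversion y as [|a s v ys|X alpha s v1 v2 Xalpha ya ys]; subst.
- have [w1 [w2 [-> y1 y2]]] := IH _ ys.
  by exists (a :: w1), w2; split=> //; constructor.
- have [w1 [w2 [-> y1 y2]]] := IH _ ys.
  exists (v1 ++ w1), w2; rewrite catA; split=> //.
  exact: YieldsNonterminal Xalpha ya y1.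
Qed.

Lemma yields_terminals w : yields (map inr w) w.
Proof. by elim: w => [|a w IH] /=; constructor. Qed.

Lemma yields_derives s w : yields s w -> derives s (map inr w).
Proof.
elim=> [|a s1 w1 _ IH|X alpha s1 w1 w2 Xalpha _ IHa _ IHs].
- exact: rt_refl.
- exact: (derives_cat (rt_refl _ _ [:: inr a]) IH).
- rewrite map_cat; apply: (derives_cat (s1 := [:: inl X])) IHs.
  exact: rt_trans (derives_production Xalpha) IHa.
Qed.

Lemma yields_derivesl s t w : derives s t -> yields t w -> yields s w.
Proof.
move=> d; elim: d w => [_ _ [u v X alpha Xalpha]|//|x y z _ IHxy _ IHyz] w.
- case/yields_catE=> w1 [_ [-> yu /yields_catE[w2 [w3 [-> ya yv]]]]].
  exact: yields_cat yu (YieldsNonterminal Xalpha ya yv).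
- by move=> /IHyz/IHxy.
Qed.

Lemma derivesP s w : derives s (map inr w) <-> yields s w.
Proof.
split=> [d|]; last exact: yields_derives.
exact: yields_derivesl d (yields_terminals w).
Qed.

Fixpoint denotes (P : nonterminal g -> language A) (s : sentential_form g) :
    language A :=
  match s with
  | [::] => fun w => w = [::]
  | inr a :: s => fun w => exists2 w', w = a :: w' & denotes P s w'
  | inl X :: s => fun w =>
      exists w1 w2, [/\ w = w1 ++ w2, P X w1 & denotes P s w2]
  end.

Lemma yields_denotes (P : nonterminal g -> language A) s w :
  (forall X alpha u, (X, alpha) \in productions g ->
     denotes P alpha u -> P X u) ->
  yields s w -> denotes P s w.
Proof.
move=> closedP; elim=> [|a s1 w1 _ IH|X alpha s1 w1 w2 Xalpha _ IHa _ IHs] //=.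
- by exists w1.
- by exists w1, w2; split=> //; apply: closedP IHa.
Qed.

End Derivations.

(** * From a grammar to a groupoid *)

Section GrammarToGroupoid.

Variables (A : finType) (g : grammar A).

(* The successor leaves room for the one-symbol forms. *)
Let K := (\max_(p <- productions g) size p.2).+1.

Definition item : finType := K.-bseq (nonterminal g + A).

Definition item_op (X Y : {set item}) : {set item} :=
  [set alpha : item | `[< exists beta gamma : item,
     [/\ beta \in X, gamma \in Y &
         derives (g := g) alpha (val beta ++ val gamma)] >]].

Definition item_letter (a : A) : {set item} :=
  [set alpha : item | `[< yields (g := g) alpha [:: a] >]].

Lemma production_size X alpha :
  (X, alpha) \in productions g -> size alpha <= K.
Proof.
by move=> Xalpha; apply/leqW/(leq_bigmax_seq (P := xpredT) _ Xalpha).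
Qed.

Lemma evaluate_yields t w (alpha : item) :
  frontier t = map item_letter w -> alpha \in evaluate item_op t ->
  yields (g := g) alpha w.
Proof.
elim: t w alpha => [X|l IHl r IHr] w alpha /=.
  by case: w => [|a [|? ?]] //= [->]; rewrite inE => /asboolP.
move=> front; rewrite inE => /asboolP[beta [gamma [bl cr]]].
move/yields_derivesl; apply.
have frontl : frontier l = map item_letter (take (size (frontier l)) w).
  by rewrite map_take -front take_size_cat.
have frontr : frontier r = map item_letter (drop (size (frontier l)) w).
  by rewrite map_drop -front drop_size_cat.
rewrite -(cat_take_drop (size (frontier l)) w).
exact: yields_cat (IHl _ _ frontl bl) (IHr _ _ frontr cr).
Qed.

(** Descent in the derivation forest. If the first symbol and the rest both contribute letters, the
    cut falls between them. If the first symbol yields the empty word, it is erased and the rest is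
    split; if the rest does, it is erased and the first symbol is expanded to a right-hand side,
    again of length at most [K]. *)
Lemma yields_split (s : sentential_form g) w :
  yields s w -> size s <= K -> 1 < size w ->
  exists (beta gamma : item) (w1 w2 : seq A),
    [/\ w = w1 ++ w2, 0 < size w1, 0 < size w2,
        derives s (val beta ++ val gamma) &
        yields (g := g) beta w1 /\ yields (g := g) gamma w2].
Proof.
have sz1 (x : nonterminal g + A) : size [:: x] <= K by [].
elim=> [|a s1 v ys _|X alpha s1 w1 w2 Xalpha ya IHa ys IHs] //= sz.
  move=> szv; exists (Bseq (sz1 (inr a))), (Bseq (ltnW sz)), [:: a], v.
  split=> //; first exact: rt_refl.
  by split=> //; apply: (yields_terminals g [:: a]).
have dX : derives (g := g) [:: inl X] alpha by apply: derives_production.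
have yX : yields (g := g) [:: inl X] w1 by apply: yields_derivesl dX ya.
case: w1 ya IHa yX => [|a1 w1] ya IHa yX.
  move=> /(IHs (ltnW sz))[beta [gamma [v1 [v2 [-> v1p v2p d y]]]]].
  exists beta, gamma, v1, v2; split=> //; apply: rt_trans d.
  exact: (derives_cat (yields_derives yX) (rt_refl _ _ s1)).
case: w2 ys IHs => [|a2 w2] ys _ szw.
  rewrite cats0 in szw *.
  have [beta [gamma [v1 [v2 [-> v1p v2p d y]]]]] :=
    IHa (production_size Xalpha) szw.
  exists beta, gamma, v1, v2; split=> //; apply: rt_trans d.
  rewrite -[alpha]cats0.
  exact: (derives_cat dX (yields_derives ys)).
exists (Bseq (sz1 (inl X))), (Bseq (ltnW sz)), (a1 :: w1), (a2 :: w2).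
by split=> //; apply: rt_refl.
Qed.

Lemma yields_evaluate w (alpha : item) :
  0 < size w -> yields (g := g) alpha w ->
  exists2 t, frontier t = map item_letter w & alpha \in evaluate item_op t.
Proof.
have [k] := ubnP (size w); elim: k w alpha => // k IH w alpha szw wp yw.
case: (leqP (size w) 1) => [szw1|szw1].
  case: w szw1 {szw} wp yw => [|a [|? ?]] // _ _ yw.
  by exists (Leaf (item_letter a)); rewrite // inE; apply/asboolP.
have [beta [gamma [w1 [w2 [Ew w1p w2p d [y1 y2]]]]]] :=
  yields_split yw (size_bseq alpha) szw1.
have [|t1 f1 b1] := IH _ _ _ w1p y1.
  by apply: leq_trans (_ : size w <= k); rewrite // Ew size_cat -addn1 leq_add2l.
have [|t2 f2 b2] := IH _ _ _ w2p y2.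
  by apply: leq_trans (_ : size w <= k); rewrite // Ew size_cat -add1n leq_add2r.
exists (Node t1 t2); first by rewrite /= f1 f2 Ew map_cat.
by rewrite inE; apply/asboolP; exists beta, gamma.
Qed.

Definition start_item : item :=
  Bseq (isT : size [:: inl (start g) : nonterminal g + A] <= K).

Definition accepting : {set {set item}} :=
  [set X : {set item} | start_item \in X].

Lemma generated_groupoid w :
  0 < size w ->
  generated g w <->
  groupoid_language item_op accepting (map item_letter w).
Proof.
move=> wp; split.
- move=> /derivesP yw.
  have [t ft st] := yields_evaluate (alpha := start_item) wp yw.
  by exists t; split; rewrite ?inE.
- by move=> [t [ft]]; rewrite inE => /(evaluate_yields ft)/derivesP.
Qed.

End GrammarToGroupoid.

(** * Letter-to-letter maps as unary quantifiers *)

Section LetterMaps.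

Variables (A : finType) (G : eqType) (h : A -> G).

(** A disjunction over the letters that [h] sends to [x]; its base case is falsehood, expressed by a
    negated equation. *)
Definition letter_in (x : G) : formula A 1 :=
  foldr (fun a => Or (Letter a (Var ord0))) (Not (Equal A Min Min))
    [seq a <- enum A | h a == x].

Lemma holds_letter_in x n (w : n.+1.-tuple A) v :
  holds w (letter_in x) v = (h (tnth w (v ord0)) == x).
Proof.
have -> : (h (tnth w (v ord0)) == x) =
    (tnth w (v ord0) \in [seq a <- enum A | h a == x]).
  by rewrite mem_filter mem_enum andbT.
by rewrite /letter_in; elim: filter => //= a s ->; rewrite in_cons.
Qed.

Lemma lindstrom_word_letter_map m (b : 'I_m.+1 -> G) n (w : n.+1.-tuple A) :
  bijective b ->
  lindstrom_word b [tuple letter_in (b (widen_ord (leqnSn m) j)) | j < m] w =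
  map h w :> seq G.
Proof.
case=> c bK cK.
rewrite -[in RHS](map_tnth_enum w) -map_comp /=.
apply: eq_map => i /=; set x := h _.
rewrite find_map.
set P := preim _ _.
suff E : find P (enum 'I_m) = c x by rewrite E inord_val cK.
have PE j : P j = (widen_ord (leqnSn m) j == c x).
  by rewrite /P /= holds_letter_in -/x -{1}(cK x) (inj_eq (can_inj bK)) eq_sym.
rewrite (eq_find PE).
case: (ltnP (c x) m) => [cm|mc].
- rewrite -[RHS](index_enum_ord (Ordinal cm)).
  by apply: eq_find => j /=; rewrite -!val_eqE.
(* The last letter of the enumeration has no formula: all [m] formulas fail, and [find] then returns
   the length [m]. *)
- have -> : val (c x) = m by apply/eqP; rewrite eqn_leq mc -ltnS ltn_ord.
  rewrite hasNfind ?size_enum_ord //; apply/hasPn => j _.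
  by rewrite -val_eqE /= neq_ltn (leq_trans (ltn_ord j) mc).
Qed.

End LetterMaps.

Lemma finType_ordinal_bijection (G : finType) :
  0 < #|G| -> exists m (b : 'I_m.+1 -> G), bijective b.
Proof.
case E: #|G| => [|m] // _; exists m, (fun i => enum_val (cast_ord (esym E) i)).
exists (fun x => cast_ord E (enum_rank x)) => x.
- by rewrite enum_valK cast_ordKV.
- by rewrite cast_ordK enum_rankK.
Qed.

Lemma CFL_QunGrpFO (A : finType) (L : language A) : CFL L -> QunGrpFO L.
Proof.
case=> L0 [g Lg]; split=> //.
have Gp : 0 < #|{set item g}| by apply/card_gt0P; exists set0.
have [m [b bij_b]] := finType_ordinal_bijection Gp.
exists {set item g}, (@item_op A g), (accepting g), m, b.
exists [tuple letter_in (@item_letter A g) (b (widen_ord (leqnSn m) j)) | j < m].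
split=> // n w.
have wp : 0 < size w by rewrite size_tuple.
by rewrite /lindstrom lindstrom_word_letter_map // Lg; apply: generated_groupoid.
Qed.

(** * Functions on words that factor through finite algebras *)

Definition compositional (B : Type) (M : Type) (mul : M -> M -> M)
    (h : seq B -> M) : Prop :=
  forall u v, h (u ++ v) = mul (h u) (h v).

(** The image of [h] is a monoid under [mul] with unit [h [::]], so this is recognition by a finite
    monoid. *)
Definition recognizable (B T : Type) (F : seq B -> T) : Prop :=
  exists (M : finType) (mul : M -> M -> M) (h : seq B -> M) (r : M -> T),
    compositional mul h /\ forall u, F u = r (h u).

Lemma compositional_recognizable (B : Type) (M : finType) (mul : M -> M -> M)
  (h : seq B -> M) : compositional mul h -> recognizable h.
Proof. by move=> hM; exists M, mul, h, id. Qed.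

Lemma recognizable_comp (B T U : Type) (f : T -> U) (F : seq B -> T) :
  recognizable F -> recognizable (fun u => f (F u)).
Proof.
case=> M [mul [h [r [hM Fr]]]]; exists M, mul, h, (f \o r); split=> // u.
by rewrite /= Fr.
Qed.

Lemma recognizable_comp2 (B T U V : Type) (f : T -> U -> V) (F : seq B -> T)
  (F' : seq B -> U) :
  recognizable F -> recognizable F' -> recognizable (fun u => f (F u) (F' u)).
Proof.
case=> M [mul [h [r [hM Fr]]]] [M' [mul' [h' [r' [hM' Fr']]]]].
exists (M * M')%type, (fun x y => (mul x.1 y.1, mul' x.2 y.2)),
  (fun u => (h u, h' u)), (fun x => f (r x.1) (r' x.2)).
by split=> [u v|u]; rewrite /= ?hM ?hM' ?Fr ?Fr'.
Qed.

Lemma recognizable_has (B : Type) (P : pred B) : recognizable (has P).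
Proof. by apply: (compositional_recognizable (mul := orb)); apply: has_cat. Qed.

Fixpoint before (B : Type) (P Q : pred B) (u : seq B) : bool :=
  if u is c :: u' then P c && has Q u' || before P Q u' else false.

Lemma before_cat (B : Type) (P Q : pred B) u v :
  before P Q (u ++ v) = [|| before P Q u, before P Q v | has P u && has Q v].
Proof.
elim: u => [|c u IH] /=; first by rewrite orbF.
rewrite IH has_cat.
by case: (P c) (has Q u) (has Q v) (before P Q u) (before P Q v) (has P u)
  => [] [] [] [] [] [].
Qed.

(** An occurrence across a cut needs [P] on the left and [Q] on the right, so the presence of each
    is recorded next to [before P Q]; the triple is compositional. *)
Lemma recognizable_before (B : Type) (P Q : pred B) : recognizable (before P Q).
Proof.
pose mul (x y : bool * (bool * bool)) :=
  ([|| x.1, y.1 | x.2.1 && y.2.2], (x.2.1 || y.2.1, x.2.2 || y.2.2)).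
have hM : compositional mul (fun u => (before P Q u, (has P u, has Q u))).
  by move=> u v; rewrite before_cat !has_cat.
exact: (recognizable_comp fst (compositional_recognizable hM)).
Qed.

Lemma before_pairwise n (s : seq 'I_n) (p q : 'I_n) :
  pairwise (fun i j : 'I_n => i < j) s -> p \in s -> q \in s ->
  before (fun i => p == i) (fun i => q == i) s = (p < q).
Proof.
have hasE (x : 'I_n) t : has (fun i => x == i) t = (x \in t).
  by rewrite -has_pred1; apply: eq_has => i; rewrite /= eq_sym.
have absent t : (p \notin t) || (q \notin t) ->
    before (fun i => p == i) (fun i => q == i) t = false.
  elim: t => //= i t IH; rewrite !in_cons !negb_or => H.
  rewrite IH; last by case/orP: H => /andP[_ ->]; rewrite ?orbT.
  rewrite orbF hasE; apply/negP=> /andP[/eqP pi qt].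
  by case/orP: H; rewrite ?pi ?eqxx // qt andbF.
elim: s => //= i s IH /andP[/allP lti pws].
(* No position recurs in an increasing list, so [absent] settles the tail once the head is [p] or
   [q]. *)
have ltii : i \notin s by apply/negP => /lti; rewrite ltnn.
rewrite !in_cons hasE.
case: (eqVneq p i) lti ltii => [<-|pi] lti ltii /=.
  move=> _; rewrite absent ?ltii // orbF.
  by case: (eqVneq q p) => [->|_] /=;
    [rewrite (negbTE ltii) ltnn|move=> qs; rewrite qs lti].
move=> ps; case: (eqVneq q i) lti ltii => [<-|_] lti ltii /=; last exact: IH.
by rewrite absent ?ltii ?orbT // ltnNge ltnW ?lti.
Qed.

(* A letter, whether its position is the first or the last of the word (for
   [Min] and [Max]), and which variables denote that position. *)
Definition marked_letter (A : finType) (k : nat) : finType :=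
  ((A * (bool * bool)) * {ffun 'I_k -> bool})%type.

Definition mark (A : finType) (k : nat) (c : bool) (x : marked_letter A k) :
    marked_letter A k.+1 :=
  (x.1, [ffun y => extend c x.2 y]).

(** The possible values of a newly quantified variable: each listed word marks exactly one position
    with it. *)
Fixpoint markings (A : finType) (k : nat) (u : seq (marked_letter A k)) :
    seq (seq (marked_letter A k.+1)) :=
  if u is x :: u' then
    (mark true x :: map (mark false) u') :: map (cons (mark false x)) (markings u')
  else [::].

Lemma markings_cat A k (u v : seq (marked_letter A k)) :
  markings (u ++ v) =
  map (cat^~ (map (mark false) v)) (markings u) ++
  map (cat (map (mark false) u)) (markings v).
Proof.
elim: u => [|x u IH] /=; first by rewrite map_id.
by rewrite map_cat IH map_cat -!map_comp.
Qed.

Lemma markings_map A k (I : eqType) (F : I -> marked_letter A k) (s : seq I) :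
  uniq s ->
  markings (map F s) = [seq [seq mark (p == i) (F i) | i <- s] | p <- s].
Proof.
elim: s => //= i s IH /andP[is_ us]; rewrite IH // eqxx -!map_comp; congr (_ :: _).
- congr (_ :: _); apply/eq_in_map => j js /=.
  by case: eqP js is_ => // -> ->.
- apply/eq_in_map => p ps /=.
  by case: eqP ps is_ => // -> ->.
Qed.

(** A powerset construction: the value of the unmarked word is kept with the set of values of its
    markings. In a concatenation the mark lies in one factor and the other stays unmarked, so these
    data multiply. *)
Lemma recognizable_markings A k (P : pred (seq (marked_letter A k.+1))) :
  recognizable P ->
  recognizable (fun u : seq (marked_letter A k) => has P (markings u)).
Proof.
case=> M [mul [h [r [hM Pr]]]].
pose unmarked (u : seq (marked_letter A k)) := h (map (mark false) u).
pose marked u : {set M} := [set x in map h (markings u)].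
pose mul' (x y : M * {set M}) :=
  (mul x.1 y.1, [set mul z y.1 | z in x.2] :|: [set mul x.1 z | z in y.2]).
have hM' : compositional mul' (fun u => (unmarked u, marked u)).
  move=> u v; rewrite /mul' /unmarked map_cat hM; congr (_, _).
  apply/setP=> x; rewrite !inE markings_cat map_cat mem_cat -!map_comp.
  congr orb; apply/mapP/imsetP => [[w wm ->]|[y]].
  - by exists (h w); rewrite ?inE ?map_f //= hM.
  - by rewrite inE => /mapP[w wm -> ->]; exists w; rewrite //= hM.
  - by exists (h w); rewrite ?inE ?map_f //= hM.
  - by rewrite inE => /mapP[w wm -> ->]; exists w; rewrite //= hM.
suff E u : has P (markings u) = [exists x in marked u, r x].
  have := recognizable_comp (fun x : M * {set M} => [exists y in x.2, r y])
    (compositional_recognizable hM').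
  by case=> N [m [g [t [gM Et]]]]; exists N, m, g, t; split=> // u; rewrite E Et.
apply/hasP/existsP => [[w wm Pw]|[x /andP[]]].
- by exists (h w); rewrite inE map_f //= -Pr.
- by rewrite inE => /mapP[w wm ->] rw; exists w; rewrite ?Pr.
Qed.

(** * First-order formulas are recognizable *)

Section Formulas.

Variable A : finType.

Definition marked_word n (w : n.+1.-tuple A) k (v : 'I_k -> 'I_n.+1) :
    seq (marked_letter A k) :=
  [seq ((tnth w i, (ord0 == i, ord_max == i)), [ffun x => v x == i])
  | i <- enum 'I_n.+1].

Definition term_at k (t : term k) (x : marked_letter A k) : bool :=
  match t with
  | Var y => x.2 y
  | Min => x.1.2.1
  | Max => x.1.2.2
  end.

Lemma markings_marked_word n (w : n.+1.-tuple A) k (v : 'I_k -> 'I_n.+1) :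
  markings (marked_word w v) =
  [seq marked_word w (extend p v) | p <- enum 'I_n.+1].
Proof.
rewrite markings_map ?enum_uniq //; apply: eq_map => p; apply: eq_map => i.
congr (_, _); apply/ffunP=> x; rewrite !ffunE /extend.
by case: unlift => // y; rewrite ffunE.
Qed.

Lemma term_at_marked n (w : n.+1.-tuple A) k (v : 'I_k -> 'I_n.+1) t i :
  term_at t ((tnth w i, (ord0 == i, ord_max == i)), [ffun x => v x == i]) =
  (eval_term v t == i).
Proof. by case: t => [x||] //=; rewrite ffunE. Qed.

(** Induction on the formula. Atoms ask for a position with given marks, or for two such positions
    in order; connectives combine recognizable functions; quantifiers range over the markings. *)
Lemma formula_recognizable k (phi : formula A k) :
  exists P : pred (seq (marked_letter A k)),
    recognizable P /\
    forall n (w : n.+1.-tuple A) v, holds w phi v = P (marked_word w v).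
Proof.
elim: phi => {k} [k a t|k t u|k t u|k f [P [Pr PE]]|k f [P [Pr PE]] g [Q [Qr QE]]
  |k f [P [Pr PE]] g [Q [Qr QE]]|k f [P [Pr PE]]|k f [P [Pr PE]]] /=.
- exists (has (fun x => term_at t x && (x.1.1 == a))).
  split=> [|n w v]; first exact: recognizable_has.
  rewrite has_map (eq_has (a2 := fun i => (eval_term v t == i) && (tnth w i == a))).
    apply/idP/hasP => [ha|[i _ /andP[/eqP-> //]]].
    by exists (eval_term v t); rewrite ?mem_enum ?eqxx.
  by move=> i; rewrite /= term_at_marked.
- exists (before (term_at t) (term_at u)).
  split=> [|n w v]; first exact: recognizable_before.
  have before_map (s : seq 'I_n.+1) :
      before (term_at t) (term_at u) [seq ((tnth w i, (ord0 == i, ord_max == i)),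
        [ffun x => v x == i]) | i <- s] =
      before (fun i => eval_term v t == i) (fun i => eval_term v u == i) s.
    elim: s => //= i s ->; rewrite term_at_marked has_map; congr (_ && _ || _).
    by apply: eq_has => j; rewrite /= term_at_marked.
  rewrite before_map before_pairwise ?mem_enum //.
  rewrite -(pairwise_map val (fun i j => i < j)) val_enum_ord.
  by rewrite -sorted_pairwise ?iota_ltn_sorted //; apply: ltn_trans.
- exists (has (fun x => term_at t x && term_at u x)).
  split=> [|n w v]; first exact: recognizable_has.
  rewrite has_map
    (eq_has (a2 := fun i => (eval_term v t == i) && (eval_term v u == i))).
    apply/eqP/hasP => [tu|[i _ /andP[/eqP-> /eqP-> //]]].
    by exists (eval_term v t); rewrite ?mem_enum // -tu eqxx.
  by move=> i; rewrite /= !term_at_marked.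
- exists (fun u => ~~ P u); split=> [|n w v]; last by rewrite PE.
  exact: recognizable_comp.
- exists (fun u => P u && Q u); split=> [|n w v]; last by rewrite PE QE.
  exact: recognizable_comp2.
- exists (fun u => P u || Q u); split=> [|n w v]; last by rewrite PE QE.
  exact: recognizable_comp2.
- exists (fun u => has P (markings u)).
  split=> [|n w v]; first exact: recognizable_markings.
  rewrite markings_marked_word has_map.
  apply/existsP/hasP => [[p]|[p _]] /=; last by rewrite -PE; exists p.
  by rewrite PE => Pp; exists p; rewrite ?mem_enum.
- exists (fun u => ~~ has (fun u' => ~~ P u') (markings u)).
  split=> [|n w v].
    apply: recognizable_comp; apply: recognizable_markings.
    exact: recognizable_comp.
  rewrite markings_marked_word has_map -all_predC.
  apply/forallP/allP => [Pp p _|Pp p] /=; first by rewrite negbK -PE.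
  by have := Pp p; rewrite mem_enum /= negbK -PE; apply.
Qed.

(** The least true index is a function of the truth values of the formulas, each recognizable, so a
    product of their algebras computes it. *)
Lemma find_recognizable k (phis : seq (formula A k)) :
  exists F : seq (marked_letter A k) -> nat,
    recognizable F /\
    forall n (w : n.+1.-tuple A) v,
      find (fun phi => holds w phi v) phis = F (marked_word w v).
Proof.
elim: phis => [|phi phis [F [Fr FE]]].
  exists (fun=> 0); split=> //.
  by exists unit, (fun _ _ => tt), (fun=> tt), (fun=> 0).
have [P [Pr PE]] := formula_recognizable phi.
exists (fun u => if P u then 0 else (F u).+1); split=> [|n w v] /=.
  exact: (recognizable_comp2 (fun (b : bool) i => if b then 0 else i.+1)).
by rewrite PE FE.
Qed.

End Formulas.

(** * From a groupoid and a contextual relabelling to a grammar *)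

Section ContextualRelabelling.

Variables (A : Type) (G M : Type) (h : seq A -> M) (f : M -> A -> M -> G).

(** [p] and [s] are the left and right contexts of the factor [u]; carrying them lets the
    relabelling be cut into factors. *)
Fixpoint relabel (p u s : seq A) : seq G :=
  if u is a :: u' then
    f (h p) a (h (u' ++ s)) :: relabel (rcons p a) u' s
  else [::].

Lemma size_relabel p u s : size (relabel p u s) = size u.
Proof. by elim: u p => //= a u IH p; rewrite IH. Qed.

Lemma relabel_cat p u v s :
  relabel p (u ++ v) s = relabel p u (v ++ s) ++ relabel (p ++ u) v s.
Proof.
elim: u p => [|a u IH] p /=; first by rewrite cats0.
by rewrite IH catA cat_rcons.
Qed.

Lemma nth_relabel g0 a0 p u s i :
  i < size u ->
  nth g0 (relabel p u s) i =
  f (h (p ++ take i u)) (nth a0 u i) (h (drop i.+1 u ++ s)).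
Proof.
elim: u p i => //= a u IH p [|i] iu /=; first by rewrite cats0 drop0.
by rewrite IH // cat_rcons.
Qed.

End ContextualRelabelling.

Lemma size_frontier_gt0 (G : Type) (t : bracketing G) : 0 < size (frontier t).
Proof. by elim: t => //= l IHl r _; rewrite size_cat ltn_addr. Qed.

Section GroupoidToGrammar.

Variables (A G M : finType) (op : G -> G -> G) (S : {set G}).
Variables (mul : M -> M -> M) (h : seq A -> M) (f : M -> A -> M -> G).
Hypothesis hM : compositional mul h.

(* [Some (x, y, m, d)] generates the words of value [m] which, between a left
   context of value [x] and a right context of value [y], are relabelled to a
   word that some bracketing evaluates to [d]. *)
Definition context_nonterminal : finType := option (M * M * M * G).

Definition start_production (p : M * G) :
    context_nonterminal * seq (context_nonterminal + A) :=
  (None, [:: inl (Some (h [::], h [::], p.1, p.2))]).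

Definition letter_production (p : M * M * A) :
    context_nonterminal * seq (context_nonterminal + A) :=
  let: (x, y, a) := p in
  (Some (x, y, h [:: a], f x a y), [:: inr a]).

Definition node_production (p : M * M * (M * G) * (M * G)) :
    context_nonterminal * seq (context_nonterminal + A) :=
  let: (x, y, (m1, d1), (m2, d2)) := p in
  (Some (x, y, mul m1 m2, op d1 d2),
   [:: inl (Some (x, mul m2 y, m1, d1)); inl (Some (mul x m1, y, m2, d2))]).

Definition context_grammar : grammar A :=
  @Grammar A context_nonterminal None
    ([seq start_production p | p <- enum {: M * G} & p.2 \in S] ++
     [seq letter_production p | p <- enum {: M * M * A}] ++
     [seq node_production p | p <- enum {: M * M * (M * G) * (M * G)}]).

(** The meaning intended for each nonterminal. The claim covers all contexts of values [x] and [y],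
    because a nonterminal knows its contexts only through their values. *)
Definition context_language (X : context_nonterminal) : language A :=
  match X with
  | None => groupoid_language op S \o (fun u => relabel h f [::] u [::])
  | Some (x, y, m, d) => fun u =>
      h u = m /\ forall p s, h p = x -> h s = y ->
        exists2 t, frontier t = relabel h f p u s & evaluate op t = d
  end.

Lemma context_production X alpha u :
  (X, alpha) \in productions context_grammar ->
  denotes (g := context_grammar) context_language alpha u ->
  context_language X u.
Proof.
rewrite /= !mem_cat => /or3P[] /mapP.
- case=> -[m d]; rewrite mem_filter /= => /andP[dS _] [-> ->] /=.
  case=> w1 [w2 [-> [_ H] ->]].
  have [t ft dE] := H [::] [::] erefl erefl.
  by exists t; rewrite cats0 dE.
- case=> -[[x y] a] _ [-> ->] /= [w -> ->]; split=> // p s hp hs.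
  by exists (Leaf (f x a y)); rewrite /= ?hp ?hs.
- case=> -[[[x y] [m1 d1]] [m2 d2]] _ [-> ->] /=.
  case=> u1 [_ [-> [h1 H1] [u2 [_ [-> [h2 H2] ->]]]]]; rewrite cats0.
  split=> [|p s hp hs]; first by rewrite hM h1 h2.
  (* The word of each child belongs to the context of the other: the right context of the left child
     is [u2 ++ s], of value [mul m2 y]. *)
  have [||t1 f1 <-] := H1 p (u2 ++ s); rewrite ?hM ?h2 ?hs //.
  have [||t2 f2 <-] := H2 (p ++ u1) s; rewrite ?hM ?h1 ?hp //.
  by exists (Node t1 t2); rewrite //= f1 f2 relabel_cat.
Qed.

(** The derivation tree copies the bracketing, each node carrying the true values of its factor and
    of both contexts. Relabelling preserves length, so the word is cut where the frontier of the
    left subtree ends. *)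
Lemma relabel_yields t p u s :
  frontier t = relabel h f p u s ->
  yields (g := context_grammar)
    [:: inl (Some (h p, h s, h u, evaluate op t))] u.
Proof.
elim: t p u s => [d|l IHl r IHr] p u s /=.
  case: u => [|a [|? ?]] //= [->].
  rewrite -[X in yields _ X]cats0.
  apply: YieldsNonterminal (yields_terminals _ [:: a]) (YieldsNil _).
  rewrite /= !mem_cat; apply/or3P/Or32/mapP.
  by exists (h p, h s, a); rewrite ?mem_enum.
move=> front.
have szu : size (frontier l) <= size u.
  by rewrite -(size_relabel h f p u s) -front size_cat leq_addr.
rewrite -(cat_take_drop (size (frontier l)) u) relabel_cat in front *.
set u1 := take _ u in front *; set u2 := drop _ u in front *.
have sz1 : size (frontier l) = size (relabel h f p u1 (u2 ++ s)).
  by rewrite size_relabel size_takel.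
have /andP[/eqP/IHl y1 /eqP/IHr y2] :
    (frontier l == relabel h f p u1 (u2 ++ s)) &&
    (frontier r == relabel h f (p ++ u1) u2 s).
  by rewrite -eqseq_cat // front.
rewrite -[X in yields _ X]cats0.
apply: YieldsNonterminal (yields_cat y1 y2) (YieldsNil _).
rewrite /= !mem_cat; apply/or3P/Or33/mapP.
exists (h p, h s, (h u1, evaluate op l), (h u2, evaluate op r)).
  by rewrite mem_enum.
by rewrite /= !hM.
Qed.

Lemma context_grammarP u :
  generated context_grammar u <->
  groupoid_language op S (relabel h f [::] u [::]).
Proof.
split=> [/derivesP/(yields_denotes context_production) /=|[t [ft tS]]].
  by case=> w1 [w2 [-> Lw ->]]; rewrite cats0.
apply/derivesP; rewrite -[u]cats0.
apply: YieldsNonterminal (relabel_yields ft) (YieldsNil _).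
rewrite /= !mem_cat; apply/or3P/Or31/mapP.
by exists (h u, evaluate op t); rewrite // mem_filter mem_enum tS.
Qed.

End GroupoidToGrammar.

(** * The view of a formula from one position *)

Section Ends.

Variable A : finType.

(** The booleans tell whether [u] begins or ends the whole word; only then may its first or last
    letter carry the mark for [Min] or [Max]. *)
Fixpoint mark_ends (first last : bool) (u : seq A) : seq (A * (bool * bool)) :=
  if u is a :: u' then
    (a, (first, last && nilp u')) :: mark_ends false last u'
  else [::].

Lemma mark_ends_cat first last u v :
  mark_ends first last (u ++ v) =
  mark_ends first (last && nilp v) u ++ mark_ends (first && nilp u) last v.
Proof.
elim: u first => [|a u IH] first /=; first by rewrite andbT.
by rewrite IH /= andbF /nilp size_cat addn_eq0 -andbA [nilp _ && _]andbC.
Qed.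

Lemma size_mark_ends first last u : size (mark_ends first last u) = size u.
Proof. by elim: u first => //= a u IH first; rewrite IH. Qed.

Lemma nth_mark_ends x0 a0 first last u i :
  i < size u ->
  nth x0 (mark_ends first last u) i =
  (nth a0 u i, (first && (i == 0), last && (i.+1 == size u))).
Proof.
elim: u first i => //= a u IH first [|i] iu /=.
  by rewrite andbT eqSS eq_sym.
by rewrite IH // andbF.
Qed.

Definition unmark_all (k : nat) (x : A * (bool * bool)) : marked_letter A k :=
  (x, [ffun=> false]).

(** The prefix before [i] cannot hold the last position, nor the suffix after it the first, which
    fixes their flags; [i] itself is first or last exactly when the prefix or suffix is empty. *)
Lemma marked_word_split n (w : n.+1.-tuple A) (i : 'I_n.+1) :
  marked_word w (fun _ : 'I_1 => i) =
  map (@unmark_all 1) (mark_ends true false (take i w)) ++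
  ((tnth w i, (nilp (take i w), nilp (drop i.+1 w))), [ffun=> true]) ::
  map (@unmark_all 1) (mark_ends false true (drop i.+1 w)).
Proof.
pose a0 := tnth w i.
have szt : size (take i w) = i by rewrite size_takel // size_tuple ltnW.
have tn (j : 'I_n.+1) : tnth w j = nth a0 w j by apply: tnth_nth.
have nt : nilp (take i w) = (ord0 == i) by rewrite /nilp szt eq_sym -val_eqE.
have nd : nilp (drop i.+1 w) = (ord_max == i).
  by rewrite /nilp size_drop size_tuple subSS subn_eq0 -val_eqE /=
    eqn_leq -[X in _ && X]ltnS ltn_ord andbT.
pose x0 := ((a0, (true, true)), [ffun=> true]) : marked_letter A 1.
apply: (@eq_from_nth _ x0).
  rewrite size_map size_enum_ord size_cat /= !size_map !size_mark_ends szt.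
  by rewrite size_drop size_tuple subSS addnS subnKC // -ltnS.
move=> j; rewrite size_map size_enum_ord => jn.
rewrite -[j]/(nat_of_ord (Ordinal jn)); move: (Ordinal jn) => {jn}j.
rewrite (nth_map j) ?size_enum_ord // nth_ord_enum nth_cat size_map.
rewrite size_mark_ends szt.
case: ltngtP => [ji|ij|/val_inj ij].
- rewrite (nth_map (a0, (true, true))) ?size_mark_ends ?szt //.
  rewrite (nth_mark_ends _ a0) ?szt // nth_take // -tn /unmark_all.
  congr ((_, (_, _)), _); first by rewrite eq_sym -val_eqE.
    by rewrite -val_eqE /= gtn_eqF // (leq_trans ji) // -ltnS.
  by apply/ffunP=> x; rewrite !ffunE -val_eqE /= gtn_eqF.
- case E: (j - i) => [|d] /=; first by move/eqP: E; rewrite subn_eq0 leqNgt ij.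
  have Ej : j = i.+1 + d :> nat by rewrite addSnnS -E subnKC // ltnW.
  have dn : d < size (drop i.+1 w).
    by rewrite size_drop size_tuple ltn_subRL -Ej ltn_ord.
  rewrite (nth_map (a0, (true, true))) ?size_mark_ends //.
  rewrite (nth_mark_ends _ a0) // nth_drop -Ej -tn /unmark_all.
  congr ((_, (_, _)), _); first by rewrite -val_eqE /= Ej.
    rewrite -val_eqE /= size_drop size_tuple subSS -E -[RHS](eqn_add2l i).
    by rewrite !subnKC -1?ltnS ?ltn_ord 1?eq_sym // ltnW.
  by apply/ffunP=> x; rewrite !ffunE -val_eqE /= ltn_eqF.
- rewrite ij subnn /= nt nd; congr ((_, (_, _)), _).
  by apply/ffunP=> x; rewrite !ffunE eqxx.
Qed.

Lemma marked_position_recognizable (T : Type) (F : seq (marked_letter A 1) -> T) :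
  recognizable F ->
  exists (M : finType) (mul : M -> M -> M) (h : seq A -> M) (f : M -> A -> M -> T),
    compositional mul h /\
    forall n (w : n.+1.-tuple A) (i : 'I_n.+1),
      F (marked_word w (fun=> i)) =
      f (h (take i w)) (tnth w i) (h (drop i.+1 w)).
Proof.
case=> M [mul [h [r [hM Fr]]]].
pose hend first last u := h (map (@unmark_all 1) (mark_ends first last u)).
(* A factor does not know whether it lies at an end of the word, so its values for all four choices
   of flags are stored. Its emptiness is stored too, since a neighbour lies at an end when only an
   empty factor separates them. *)
pose N : finType := (bool * {ffun bool * bool -> M})%type.
pose mulN (x y : N) : N :=
  (x.1 && y.1, [ffun e => mul (x.2 (e.1, e.2 && y.1)) (y.2 (e.1 && x.1, e.2))]).
pose hN u : N := (nilp u, [ffun e => hend e.1 e.2 u]).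
pose f (x : N) a (y : N) :=
  r (mul (x.2 (true, false))
    (mul (h [:: ((a, (x.1, y.1)), [ffun=> true])]) (y.2 (false, true)))).
exists N, mulN, hN, f; split=> [u v|n w i].
- rewrite /hN /mulN /=; congr (_, _); first by rewrite /nilp size_cat addn_eq0.
  by apply/ffunP=> e; rewrite !ffunE /hend mark_ends_cat map_cat hM.
- by rewrite Fr marked_word_split hM -cat1s hM /f /= !ffunE.
Qed.

End Ends.

(** * From unary groupoid quantifiers to context-free languages *)

Lemma QunGrpFO_CFL (A : finType) (L : language A) : QunGrpFO L -> CFL L.
Proof.
case=> L0 [G [op [S [m [b [phis [_ Lw]]]]]]]; split=> //.
have [F [Fr FE]] := find_recognizable phis.
have [M [mul [h [f [hM fE]]]]] := marked_position_recognizable Fr.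
pose f' x a y := b (inord (f x a y)).
exists (context_grammar op S mul h f') => u.
rewrite context_grammarP //.
(* The empty word lies on neither side, since every frontier is nonempty. *)
case: u => [|a u]; first by split=> // -[t [/= ft _]];
  have := size_frontier_gt0 t; rewrite ft.
rewrite -[a :: u]/(val (in_tuple (a :: u))) Lw /lindstrom.
suff -> : lindstrom_word b phis (in_tuple (a :: u)) =
  relabel h f' [::] (a :: u) [::] :> seq G by [].
apply: (@eq_from_nth _ (b ord0)); rewrite size_tuple ?size_relabel // => i iu.
rewrite (nth_relabel _ _ _ a) //.
rewrite -[i]/(val (Ordinal iu)) -tnth_nth tnth_mktuple FE fE /f' cats0.
by rewrite (tnth_nth a).
Qed.

Theorem theorem15 (A : finType) (L : language A) : QunGrpFO L <-> CFL L.
Proof. by split; [apply: QunGrpFO_CFL|apply: CFL_QunGrpFO]. Qed.
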